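(* Let $0<p<1$. Then there exists a martingale $F\in H_p(G)$ such that $$\sup_{n\in\mathbb{N}}\|S_{2^n+1}F\|_{L_{p,\infty}}=\infty .$$
   Context: $\mathbb{N}=\{0,1,2,\dots\}$. $G=\prod_{k=0}^\infty Z_2$ is the dyadic (Walsh) group, i.e. the set of sequences $x=(x_0,x_1,\dots)$, $x_k\in\{0,1\}$, with coordinatewise addition mod 2, product topology, and normalized Haar measure $\mu$ (the product of the measures giving mass $1/2$ to each point of $Z_2$). Put $I_0(x)=G$, $I_n(x)=\{y\in G: y_0=x_0,\dots,y_{n-1}=x_{n-1}\}$, and let $\zeta_n$ be the $\sigma$-algebra generated by $\{I_n(x):x\in G\}$. Rademacher functions: $r_k(x)=(-1)^{x_k}$. Walsh functions: $w_n(x)=\prod_{k\ge0}r_k(x)^{n_k}$, where $n=\sum_{k\ge0}n_k2^k$, $n_k\in\{0,1\}$. A martingale $F=(F_n,n\in\mathbb{N})$ is a martingale with respect to $(\zeta_n)_{n\in\mathbb N}$. Its maximal function is $F^*=\sup_n|F_n|$; for $0<p<\infty$, $H_p(G)$ is the space of martingales with $\|F\|_{H_p}:=\|F^*\|_p<\infty$, where $\|f\|_p^p=\int_G|f|^p\,d\mu$. The weak quasi-norm is $\|f\|_{L_{p,\infty}}^p=\sup_{\lambda>0}\lambda^p\mu(|f|>\lambda)$. Walsh–Fourier coefficients of a martingale: $\widehat F(k)=\lim_{n\to\infty}\int_GF_nw_k\,d\mu$ (the limit always exists). Partial sums: $S_nF=\sum_{k=0}^{n-1}\widehat F(k)w_k$.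 *)

(* Defs.v *)
From HB Require Import structures.
From mathcomp Require Import all_boot all_order all_algebra.
From mathcomp Require Import all_classical all_reals all_analysis.
From mathcomp Require Import lra.

Set Implicit Arguments.
Unset Strict Implicit.
Unset Printing Implicit Defensive.

Import Order.TTheory GRing.Theory Num.Theory.
Import numFieldNormedType.Exports.

Local Open Scope classical_set_scope.
Local Open Scope ring_scope.

(* The product of countably many copies of Z_2 is [cantor_space], i.e.
   nat -> bool with the product of the discrete topologies, where [true] stands
   for 1; [dyadic_group] equips it with its Borel sigma-algebra. *)
Definition dyadic_group : measurableType _ :=
  g_sigma_algebraType (@open cantor_space).

Definition addG (a x : dyadic_group) : dyadic_group := fun k => a k (+) x k.

(* [mu] is a probability, hence normalized. Existence, uniqueness and the
   description of [mu] as a product measure are [normalized_haar_exists],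
   [normalized_haar_unique] and [normalized_haarP] below. *)
Definition normalized_haar (R : realType) (mu : probability dyadic_group R) :=
  forall (a : dyadic_group) (A : set dyadic_group),
    measurable A -> mu (addG a @` A) = mu A.

(* The dyadic interval I_n(x). *)
Definition cyl (n : nat) (x : dyadic_group) : set dyadic_group :=
  [set y | forall k, (k < n)%N -> y k = x k].

Definition zeta (n : nat) : set (set dyadic_group) := <<s range (cyl n) >>.

Section definitions.
Variable R : realType.
Implicit Types (mu : probability dyadic_group R) (F : nat -> dyadic_group -> R).
Implicit Types (f : dyadic_group -> R) (p : R).

Definition rademacher (k : nat) (x : dyadic_group) : R := (-1) ^+ (x k).

Definition digit (n k : nat) : nat := (n %/ 2 ^ k) %% 2.

(* The binary digits n_k vanish for k >= n, so the product may stop at n. *)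
Definition walsh (n : nat) (x : dyadic_group) : R :=
  \prod_(k < n) rademacher k x ^+ digit n k.

(* [g_sigma_algebraType (range (cyl n))] is [dyadic_group] with the
   sigma-algebra [zeta n]; the last clause is E[F_n | zeta_m] = F_m. *)
Definition martingale mu F : Prop :=
  [/\ forall n, measurable_fun [set: g_sigma_algebraType (range (cyl n))]
                  (F n : g_sigma_algebraType (range (cyl n)) -> R),
      forall n, mu.-integrable [set: dyadic_group] (EFin \o F n) &
      forall m n, (m <= n)%N -> forall A, zeta m A ->
        (\int[mu]_(x in A) (F n x)%:E = \int[mu]_(x in A) (F m x)%:E)%E].

Definition maximal F (x : dyadic_group) : \bar R :=
  ereal_sup (range (fun n => `|F n x|%:E)).

Definition norm_Hp mu p F : \bar R := 'N[mu]_(p%:E)[maximal F]%E.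

Definition Hp mu p : set (nat -> dyadic_group -> R) :=
  [set F | martingale mu F /\ (norm_Hp mu p F < +oo)%E].

Definition weak_norm mu p f : \bar R :=
  (ereal_sup [set (l `^ p)%:E * mu [set x | (l < `|f x|)%R]
             | l in [set l : R | (0 < l)%R]] `^ p^-1)%E.

Definition fourier_coef mu F (k : nat) : R :=
  lim ((\int[mu]_x (F n x * walsh k x)) @[n --> \oo]).

Definition partial_sum mu F (n : nat) (x : dyadic_group) : R :=
  \sum_(k < n) fourier_coef mu F k * walsh k x.

End definitions.

Lemma cyl_nbhs (x : cantor_space) (U : set cantor_space) :
  nbhs x U -> exists n, cyl n x `<=` U.
Proof.
move=> xU; pose F := filter_from [set: nat] (fun n => cyl n x).
have FF : Filter F.
  apply: filter_from_filter; first by exists 0%N.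
  move=> i j _ _; exists (maxn i j) => // y xy.
  by split=> k ki; apply: xy; rewrite leq_max ki ?orbT.
suff /(_ _ xU)[n _ nU] : F --> x by exists n.
apply/cvg_sup => i A /=.
rewrite (@nbhsE (initial_topology (fun f : cantor_space => f i))).
move=> -[_ [[B oB <-] Bx] sBA].
by exists i.+1 => // y xy; apply: sBA; rewrite /= xy.
Qed.

Lemma cyl_open n (x : cantor_space) : @open cantor_space (cyl n x).
Proof.
elim: n => [|n IH].
  by rewrite (_ : cyl 0 x = setT); [exact: openT|apply/seteqP; split].
rewrite (_ : cyl n.+1 x = cyl n x `&` (proj n @^-1` [set x n])).
  apply: openI => //; apply: open_comp; last exact: discrete_open.
  by move=> y _; exact: proj_continuous.
apply/seteqP; split=> [y xy|y [xy xyn] k].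
  by split=> [k kn|]; [exact/xy/ltnW|exact: xy].
by rewrite ltnS leq_eqVlt => /predU1P[->//|/xy].
Qed.

Lemma measurable_cyl n x : measurable (cyl n x).
Proof. by apply: sub_sigma_algebra; exact: cyl_open. Qed.

Lemma cylxx n x : cyl n x x. Proof. by []. Qed.

Lemma cyl_eq n x y : cyl n x y -> cyl n y = cyl n x.
Proof.
by move=> xy; apply/seteqP; split=> z zy k kn; rewrite zy// xy.
Qed.

Definition cyls : set (set dyadic_group) :=
  [set A | A = set0 \/ exists n x, A = cyl n x].

Lemma cyls_setI : setI_closed cyls.
Proof.
move=> _ B [->|[n [x ->]]]; first by rewrite set0I; left.
case=> [->|[m [y ->]]]; first by rewrite setI0; left.
have [->|/set0P[z [xz yz]]] := eqVneq (cyl n x `&` cyl m y) set0; first by left.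
right; exists (maxn n m), z; rewrite -(cyl_eq xz) -(cyl_eq yz).
apply/seteqP; split => t; first move=> [tn tm] k.
  by rewrite leq_max => /orP[/tn|/tm].
by move=> tz; split=> k ki; apply: tz; rewrite leq_max ki ?orbT.
Qed.

Lemma measurable_cyls : @measurable _ dyadic_group = <<s cyls >>.
Proof.
apply/seteqP; split; last first.
  apply: smallest_sub; first exact: sigma_algebra_measurable.
  by move=> _ [->|[n [x ->]]]; [exact: measurable0|exact: measurable_cyl].
apply: smallest_sub; first exact: smallest_sigma_algebra.
move=> U oU; pose C (s : seq bool) : set dyadic_group :=
  if `[< cyl (size s) (nth false s) `<=` U >] then cyl (size s) (nth false s)
  else set0.
rewrite (_ : U = \bigcup_s C s).
  apply: (@countable_bigcupT_measurable _ (g_sigma_algebraType cyls)).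
    exact: countableP.
  move=> s; apply: sub_sigma_algebra; rewrite /C.
  by case: asboolP => _; [right; exists (size s), (nth false s)|left].
apply/seteqP; split=> [x Ux|x [s _]]; last first.
  by rewrite /C; case: asboolP => [sU /sU|_ []].
have [n nU] := cyl_nbhs (open_nbhs_nbhs (conj oU Ux)).
have nx : cyl n (nth false (mkseq x n)) x by move=> k kn; rewrite nth_mkseq.
exists (mkseq x n) => //; rewrite /C size_mkseq -(cyl_eq nx).
by case: asboolP.
Qed.

Lemma cyl0 x : cyl 0 x = setT.
Proof. by apply/seteqP; split. Qed.

Lemma eq_on_cyl (R : realType) (m1 m2 : probability dyadic_group R) :
  (forall n x, m1 (cyl n x) = m2 (cyl n x)) ->
  forall A, measurable A -> m1 A = m2 A.
Proof.
move=> m12; apply: (measure_unique cyls (fun=> setT)) => //.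
- exact: measurable_cyls.
- exact: cyls_setI.
- by move=> _; right; exists 0%N, point; rewrite cyl0.
- by rewrite bigcup_const.
- by move=> A [->|[n [x ->]]]; [rewrite !measure0|exact: m12].
- by move=> n; apply: le_lt_trans (probability_le1 m1 measurableT) (ltry 1).
Qed.

Lemma addGK a : involutive (addG a).
Proof. by move=> x; apply/funext => k; rewrite /addG addbA addbb. Qed.

Lemma addG_cyl n a x : addG a @^-1` cyl n x = cyl n (addG a x).
Proof.
apply/seteqP; split => y /= + k kn => /(_ k kn); rewrite /addG.
  by move=> <-; rewrite addbA addbb.
by move=> ->; rewrite addbA addbb.
Qed.

Lemma addG_image a A : addG a @` A = addG a @^-1` A.
Proof.
apply/seteqP; split => [_ [y Ay <-]|x /= Ax]; first by rewrite /= addGK.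
by exists (addG a x) => //; rewrite addGK.
Qed.

Lemma measurable_addG a : measurable_fun setT (addG a).
Proof.
apply: (measurability _ measurable_cyls) => _ [B [->|[n [x ->]]] <-].
  by rewrite preimage_set0 setI0.
by rewrite setTI addG_cyl; exact: measurable_cyl.
Qed.

(* A normalized Haar measure is exactly a product of the measures giving mass
   1/2 to each point of Z_2. *)
Lemma normalized_haarP (R : realType) (mu : probability dyadic_group R) :
  normalized_haar mu <-> forall n x, mu (cyl n x) = (2 ^- n)%:E.
Proof.
split=> [h|h a A mA].
  elim=> [x|n IH x]; first by rewrite cyl0 probability_setT expr0 invr1.
  pose e : dyadic_group := fun k => k == n.
  have D : cyl n.+1 x `&` cyl n.+1 (addG e x) = set0.
    rewrite -subset0 => y [/(_ n (ltnSn n)) + /(_ n (ltnSn n))].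
    by rewrite /addG /e eqxx => ->; case: (x n).
  have U : cyl n x = cyl n.+1 x `|` cyl n.+1 (addG e x).
    apply/seteqP; split=> [y xy|y].
      have [ynx|ynx] := eqVneq (y n) (x n); [left|right] => k.
        by rewrite ltnS leq_eqVlt => /predU1P[->//|/xy].
      rewrite ltnS leq_eqVlt /addG /e => /predU1P[->|kn].
        by move: ynx; rewrite eqxx; case: (y n); case: (x n).
      by rewrite (ltn_eqF kn) xy.
    case=> xy k kn; rewrite xy ?ltnS ?(ltnW kn)//.
    by rewrite /addG /e (ltn_eqF kn).
  have E : mu (cyl n.+1 (addG e x)) = mu (cyl n.+1 x).
    by rewrite -addG_cyl -addG_image h//; exact: measurable_cyl.
  have : mu (cyl n x) = (mu (cyl n.+1 x) + mu (cyl n.+1 (addG e x)))%E.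
    by rewrite U measureU//; exact: measurable_cyl.
  rewrite IH E.
  have : mu (cyl n.+1 x) \is a fin_num by apply: fin_num_measure; exact: measurable_cyl.
  move/fineK => <-; rewrite -EFinD => -[H]; congr EFin.
  by rewrite exprS invfM H -mulr2n -[X in _ = _ * X]mulr_natl mulKf.
rewrite addG_image.
pose f : {mfun dyadic_group >-> dyadic_group} :=
  mfun_Sub (mem_set (measurable_addG a)).
apply: (@eq_on_cyl _ (distribution mu f) mu) => // n x.
by rewrite (h n x) -(h n (addG a x)) -addG_cyl.
Qed.

Lemma normalized_haar_unique (R : realType)
    (m1 m2 : probability dyadic_group R) :
  normalized_haar m1 -> normalized_haar m2 ->
  forall A, measurable A -> m1 A = m2 A.
Proof.
move=> /normalized_haarP h1 /normalized_haarP h2.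
by apply: eq_on_cyl => n x; rewrite h1 h2.
Qed.

(* Existence: the law of the binary digits of a uniform variable on [0, 1]. *)
Section existence.
Variable R : realType.

Definition bits (t : measurableTypeR R) : dyadic_group :=
  fun k => (0 <= t < 1) && odd (Num.truncn (2 ^+ k.+1 * t)).

Fixpoint bits_index (x : dyadic_group) n : nat :=
  if n is n'.+1 then (x n' + (bits_index x n').*2)%N else 0%N.

Lemma truncn_double (s : R) : 0 <= s ->
  Num.truncn (2 * s) = (odd (Num.truncn (2 * s)) + (Num.truncn s).*2)%N.
Proof.
move=> s0; have := truncn_itv (mulr_ge0 (ler0n R 2) s0).
set m := Num.truncn _ => /andP[m1 m2].
rewrite -[LHS]odd_double_half; congr (_ + _.*2)%N; apply/esym/truncn_def.
have e : m%:R = (odd m)%:R + m./2%:R * 2 :> R.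
  by rewrite -natrM -natrD muln2 odd_double_half.
move: m1 m2; rewrite -[m.+1]addn1 -[m./2.+1]addn1 !natrD e.
by case: (odd m) => /= m1 m2; apply/andP; split; lra.
Qed.

Lemma cyl_bits n x (t : R) : 0 <= t < 1 ->
  cyl n x (bits t) <-> Num.truncn (2 ^+ n * t) = bits_index x n.
Proof.
move=> t01; have /andP[t0 t1] := t01; elim: n => [|n IH].
  split=> // _; rewrite expr0 mul1r /=; apply: truncn_def.
  by rewrite t0 t1.
have E := @truncn_double (2 ^+ n * t) (mulr_ge0 (exprn_ge0 n (ler0n R 2)) t0).
rewrite mulrA -exprS in E; split=> [h|h].
  rewrite E /= (_ : Num.truncn (2 ^+ n * t) = bits_index x n).
    by have := h _ (ltnSn n); rewrite /bits t01 /= => ->.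
  by apply/IH => k kn; apply: h; exact: ltnW.
move: (h); rewrite E /= => h' k; rewrite ltnS leq_eqVlt => /predU1P[->|kn].
  rewrite /bits t01 /=; move/(congr1 odd): h'.
  by rewrite !oddD !odd_double !addbF !oddb.
apply: IH.2 => //; move/(congr1 half): h'.
by rewrite !half_bit_double.
Qed.

Lemma cyl_bits_itv n x (t : R) : 0 <= t < 1 ->
  cyl n x (bits t) <->
  t \in `[(bits_index x n)%:R * 2 ^- n, (bits_index x n).+1%:R * 2 ^- n[.
Proof.
move=> t01; rewrite cyl_bits// in_itv /= ler_pdivrMr ?exprn_gt0//.
rewrite ltr_pdivlMr ?exprn_gt0// ![t * _]mulrC -truncn_eq.
  by split => /eqP.
by rewrite mulr_ge0 ?exprn_ge0//; case/andP: t01.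
Qed.

Lemma bits_index_lt x n : (bits_index x n < 2 ^ n)%N.
Proof.
elim: n => //= n IH; rewrite expnS mul2n.
by case: (x n); rewrite ?add0n ?ltn_double// add1n ltn_Sdouble.
Qed.

Lemma mem_bits_itv n x (t : R) :
  t \in `[(bits_index x n)%:R * 2 ^- n, (bits_index x n).+1%:R * 2 ^- n[ -> 0 <= t < 1.
Proof.
rewrite in_itv /= => /andP[t0 t1]; apply/andP; split.
  by apply: le_trans t0; rewrite mulr_ge0 ?invr_ge0 ?exprn_ge0.
apply: lt_le_trans t1 _; rewrite ler_pdivrMr ?exprn_gt0// mul1r.
by rewrite -natrX ler_nat; exact: bits_index_lt.
Qed.

Lemma measurable_bits : measurable_fun setT bits.
Proof.
apply: (measurability _ measurable_cyls) => _ [B [->|[n [x ->]]] <-].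
  by rewrite preimage_set0 setI0.
rewrite setTI.
pose I : interval R := `[(bits_index x n)%:R * 2 ^- n, (bits_index x n).+1%:R * 2 ^- n[.
pose z : dyadic_group := fun=> false.
have bz t : ~~ (0 <= t < 1) -> bits t = z.
  by move=> /negbTE t01; apply/funext => k; rewrite /bits t01.
have -> : bits @^-1` cyl n x =
    [set` I] `|` (if `[< cyl n x z >] then ~` [set` `[0, 1[] else set0).
  apply/seteqP; split=> t /=.
    have [t01|t01] := boolP (0 <= t < 1).
      by move/(cyl_bits_itv _ _ t01); left.
    rewrite bz// => xz; right; case: asboolP => // _.
    by rewrite /= in_itv /=; exact/negP.
  case=> [tI|]; first by apply/(cyl_bits_itv _ _ (mem_bits_itv tI)).
  by case: asboolP => // xz; rewrite /= in_itv /= => /negP/bz ->.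
apply: measurableU; first exact: measurable_itv.
by case: ifP => _; [apply: measurableC; exact: measurable_itv|exact: measurable0].
Qed.

Lemma normalized_haar_exists :
  exists mu : probability dyadic_group R, normalized_haar mu.
Proof.
pose f : {mfun measurableTypeR R >-> dyadic_group} :=
  mfun_Sub (mem_set measurable_bits).
exists (distribution (uniform_prob (@ltr01 R)) f).
apply/normalized_haarP => n x.
pose I : interval R := `[(bits_index x n)%:R * 2 ^- n, (bits_index x n).+1%:R * 2 ^- n[.
have mI : lebesgue_measure [set` I] = (2 ^- n)%:E :> \bar R.
  rewrite lebesgue_measure_itv /= lte_fin ltr_pM2r ?invr_gt0 ?exprn_gt0//.
  by rewrite ltr_nat ltnSn -EFinD -mulrBl -natrB// subSnn mul1r.
have mA : measurable (bits @^-1` cyl n x).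
  by rewrite -[X in measurable X]setTI; apply: measurable_bits => //; exact: measurable_cyl.
transitivity (lebesgue_measure ((bits @^-1` cyl n x) `&` `[0, 1]) : \bar R).
  rewrite /distribution /pushforward /= /uniform_prob integral_uniform_pdf.
  rewrite (eq_integral (cst 1%E)); last first.
    move=> t; rewrite inE => -[_] /=; rewrite in_itv /= => t01.
    by rewrite /uniform_pdf t01 subr0 invr1.
  by rewrite integral_cst ?mul1e//; apply: measurableI.
apply/eqP; rewrite eq_le; apply/andP; split.
  apply: (@le_trans _ _ (lebesgue_measure ([set` I] `|` [set 1]))).
    apply: le_measure; rewrite ?inE; [exact: measurableI|exact: measurableU|].
    move=> t [/= xt]; rewrite in_itv /= [t <= 1]le_eqVlt => /andP[t0 /predU1P[->|t1]].
      by right.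
    by left; apply/(cyl_bits_itv n x); rewrite ?t0 ?t1.
  have m1 := @lebesgue_measure_set1 R 1.
  apply: le_trans (measureU2 _ _ _) _ => //.
  by rewrite [X in (_ + X <= _)%E]m1 adde0 [X in (X <= _)%E]mI.
rewrite -mI; apply: le_measure; rewrite ?inE//; first exact: measurableI.
move=> t /= tI; have t01 := mem_bits_itv tI; split.
  exact/(cyl_bits_itv n x t01).
by rewrite in_itv /=; case/andP: t01 => -> /ltW ->.
Qed.

End existence.

(* Main.v *)
Require Import Defs.
From mathcomp Require Import all_boot all_order all_algebra.
From mathcomp Require Import all_classical all_reals all_analysis.
From mathcomp Require Import lra measurable_realfun.

(* Let 2 < b < 2^(1/p) and F_n = sum_{m<n} b^m r_m 1_{I_m(0)}. If j is the
   largest index below n with x in I_j(0), or j = 0 if there is none, then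
   |F_n(x)| <= 2 b^j; hence (F^* )^p <= sum_j (2 b^j)^p 1_{I_j(0)}, whose integral
   is a geometric series of ratio b^p / 2 < 1, and F is in H_p. On the other
   hand the coefficient of F at 2^n is (b/2)^n, which is unbounded. Changing the
   n-th coordinate of x preserves mu and S_{2^n}F and reverses the sign of
   w_{2^n} = r_n, so |S_{2^n+1}F| >= (b/2)^n at x or at the modified point, that
   is, on a set of measure at least 1/2. *)

Set Implicit Arguments.
Unset Strict Implicit.

Import Order.TTheory GRing.Theory Num.Theory.
Import numFieldNormedType.Exports.
Local Open Scope classical_set_scope.
Local Open Scope ring_scope.

(** * Functions and sets determined by the first [n] coordinates *)

Definition depends_on {T : Type} (n : nat) (f : dyadic_group -> T) :=
  forall x y, cyl n x y -> f y = f x.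

Lemma depends_onW {T : Type} n m (f : dyadic_group -> T) :
  (n <= m)%N -> depends_on n f -> depends_on m f.
Proof. by move=> nm fn x y xy; apply: fn => k kn; apply/xy/(leq_trans kn). Qed.

Lemma depends_on_comp2 {T U V : Type} (op : T -> U -> V) n f g :
  depends_on n f -> depends_on n g -> depends_on n (fun x => op (f x) (g x)).
Proof. by move=> fn gn x y xy; rewrite (fn _ _ xy) (gn _ _ xy). Qed.

Lemma depends_on_bigop {T : Type} (op : T -> T -> T) idx I (r : seq I) n f :
  (forall i, depends_on n (f i)) ->
  depends_on n (fun x => \big[op/idx]_(i <- r) f i x).
Proof. by move=> fn x y xy; apply: eq_bigr => i _; exact: fn. Qed.

Lemma depends_on_cyl n z : depends_on n (cyl n z).
Proof.
move=> x y xy; apply/propext; split => zz k kn; first by rewrite -xy// zz.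
by rewrite xy// zz.
Qed.

(** Sets determined by [n] coordinates form a sigma-algebra containing the cylinders. Conversely
    such a set is a union of cylinders, indexed by finite bit sequences so that the union is
    countable; [nth false] pads the short ones, and only the first [n] bits matter. *)
Lemma zetaE n A : zeta n A <-> depends_on n A.
Proof.
split=> [|An].
  apply: smallest_sub => [|_ [z _ <-]]; last exact: depends_on_cyl.
  split=> [x y _//|B Bn x y xy|B Bn x y xy].
    by rewrite /setD /mkset (Bn _ _ xy).
  by apply/propext; split=> -[i _ Bi]; exists i => //; move: Bi;
    rewrite (Bn i x y xy).
have -> : A = \bigcup_s (if `[< A (nth false s) >] then cyl n (nth false s)
                         else set0).
  apply/seteqP; split=> [x Ax|x [s _]]; last first.
    by case: asboolP => // + sx; rewrite (An _ x sx).
  have xs : cyl n x (nth false (mkseq x n)) by move=> k kn; rewrite nth_mkseq.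
  exists (mkseq x n) => //; rewrite (An x _ xs) asboolT//.
  by rewrite (cyl_eq xs); exact: cylxx.
apply: (@countable_bigcupT_measurable _ (g_sigma_algebraType (range (cyl n)))).
  exact: countableP.
move=> s; case: asboolP => _; last exact: measurable0.
by apply: sub_sigma_algebra; exists (nth false s).
Qed.

Lemma zeta_measurable n A : zeta n A -> measurable (A : set dyadic_group).
Proof.
apply: smallest_sub => [|_ [z _ <-]]; last exact: measurable_cyl.
exact: sigma_algebra_measurable.
Qed.

Lemma depends_on_indic (R : realType) n (A : set dyadic_group) :
  depends_on n A -> depends_on n (\1_A : dyadic_group -> R).
Proof.
by move=> An x y xy; rewrite !indicE /in_mem /= /in_set (An x y xy).
Qed.

(** * Flipping one coordinate: a measure-preserving involution *)

Section flip.
Variables (R : realType) (mu : probability dyadic_group R).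
Hypothesis mu_haar : normalized_haar mu.
Implicit Types (f g : dyadic_group -> R).

Lemma depends_on_preimage {T : Type} n (f : dyadic_group -> T) B :
  depends_on n f -> zeta n (f @^-1` B).
Proof.
by move=> fn; apply/zetaE => x y xy; rewrite /preimage /mkset (fn _ _ xy).
Qed.

Lemma depends_on_measurable n f : depends_on n f -> measurable_fun setT f.
Proof.
move=> fn _ B mB; rewrite setTI; apply: zeta_measurable.
exact: depends_on_preimage fn.
Qed.

Lemma depends_on_emeasurable n f :
  depends_on n f -> measurable_fun setT (fun x => (f x)%:E).
Proof.
by move=> fn; apply/measurable_EFinP; exact: depends_on_measurable fn.
Qed.

Lemma depends_on_integrable n f D : depends_on n f -> measurable D ->
  mu.-integrable D (EFin \o f).
Proof.
move=> fn mD; apply: measurable_bounded_integrable => //.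
- by rewrite (le_lt_trans (probability_le1 _ _)) ?ltry.
- by apply: measurable_funTS; exact: depends_on_measurable fn.
(* [f] takes at most [2 ^ n] values, one per prefix, and the sum of their absolute values bounds
   each of them. *)
exists (\sum_(s : n.-tuple bool) `|f (nth false s)|).
split; first exact: num_real.
move=> M /ltW sM x _; apply: le_trans sM.
pose s := mktuple (fun i : 'I_n => x i).
have xs : cyl n x (nth false s).
  by move=> k kn; rewrite -[k]/(nat_of_ord (Ordinal kn)) -tnth_nth tnth_mktuple.
by rewrite -(fn _ _ xs) (bigD1 s)//= lerDl sumr_ge0.
Qed.

Definition flip (n : nat) : dyadic_group -> dyadic_group :=
  addG (fun k => k == n).

Lemma flip_neq n k x : k != n -> flip n x k = x k.
Proof. by rewrite /flip /addG => /negbTE ->. Qed.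

Lemma flip_cyl n x : cyl n x (flip n x).
Proof. by move=> k kn; rewrite flip_neq// ltn_eqF. Qed.

Lemma depends_on_flip {T : Type} n (f : dyadic_group -> T) x :
  depends_on n f -> f (flip n x) = f x.
Proof. by move=> fn; exact/fn/flip_cyl. Qed.

Lemma flip_preserving n A : measurable A -> mu (flip n @^-1` A) = mu A.
Proof. by move=> mA; rewrite -addG_image mu_haar. Qed.

(** The flip preserves [mu] and [D], so the change of variable shows that the integral, which is
    finite, equals its own opposite. This one cancellation yields both the martingale property and
    the vanishing terms in the Fourier coefficients. *)
Lemma integral_flip_odd n N D g : measurable D -> flip n @^-1` D = D ->
  depends_on N g -> (forall x, g (flip n x) = - g x) ->
  (\int[mu]_(x in D) (g x)%:E = 0)%E.
Proof.
move=> mD Dn gN gn.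
have intg : mu.-integrable D (EFin \o g) by exact: depends_on_integrable gN mD.
have E : (\int[mu]_(x in D) (g x)%:E = - \int[mu]_(x in D) (g x)%:E)%E.
  rewrite -integralN ?integrable_add_def//.
  transitivity (\int[pushforward mu (flip n)]_(x in D) (g x)%:E)%E.
    apply: eq_measure_integral => [|? A mA _]; first exact: measurable_addG.
    by apply: esym; exact: flip_preserving.
  have intgf : mu.-integrable (flip n @^-1` D) ((EFin \o g) \o flip n).
    rewrite Dn (_ : _ \o _ = \- (EFin \o g))%E ?integrableN//.
    by apply/funext => x /=; rewrite gn.
  rewrite (integral_pushforward (measurable_addG _) _ intgf mD).
    by rewrite Dn; apply: eq_integral => x _ /=; rewrite gn.
  exact: depends_on_emeasurable gN.
have := integral_fune_fin_num mD intg.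
move: E; rewrite /comp; case: (integral _ _ _) => // r [rN] _.
by congr EFin; lra.
Qed.

(* [A] and its translate by the flip cover the group, so [mu A >= 1/2]. *)
Lemma measure_ge_half_flip n N f (c l : R) :
  (forall x, c <= `|f x| \/ c <= `|f (flip n x)|) -> depends_on N f ->
  l < c -> (2^-1%:E <= mu [set x | (l < `|f x|)%R])%E.
Proof.
move=> fc fN lc; set A := [set x | _].
have mA : measurable A.
  apply: (@zeta_measurable N); apply/zetaE => x y xy.
  by rewrite /A /mkset (fN _ _ xy).
have : (1 <= mu A + mu A)%E.
  rewrite -[X in (_ <= X + _)%E](flip_preserving n)// addeC.
  rewrite -(probability_setT mu).
  have mfA : measurable (flip n @^-1` A).
    by rewrite -[X in measurable X]setTI; exact: measurable_addG.
  apply: le_trans (measureU2 mu mA mfA); apply: le_measure; rewrite ?inE//.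
    exact: measurableU.
  by move=> x _; case: (fc x) => /(lt_le_trans lc); [left|right].
have : mu A \is a fin_num by exact: fin_num_measure.
by move/fineK => <-; rewrite -EFinD !lee_fin; lra.
Qed.

End flip.

(** * Walsh functions at powers of two *)

Lemma digit_pow2 n k : digit (2 ^ n) k = (k == n).
Proof.
rewrite /digit; case: ltngtP => [kn|nk|->].
- by rewrite -(subnKC kn) addSnnS expnD mulKn ?expn_gt0// expnS modnMr.
- by rewrite divn_small// ltn_exp2l.
- by rewrite divnn expn_gt0.
Qed.

Section walsh.
Context {R : realType}.

Lemma depends_on_rademacher k : depends_on k.+1 (rademacher R k).
Proof. by move=> x y xy; rewrite /rademacher xy. Qed.

Lemma rademacher_flip k x : rademacher R k (flip k x) = - rademacher R k x.
Proof.
by rewrite /rademacher /flip /addG eqxx addTb; case: (x k); rewrite ?opprK.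
Qed.

Lemma rademacher_sqr k x : rademacher R k x * rademacher R k x = 1.
Proof. by rewrite -expr2 /rademacher sqrr_sign. Qed.

Lemma normr_rademacher k x : `|rademacher R k x| = 1.
Proof. exact: normr_sign. Qed.

Lemma walsh_pow2 n x : walsh R (2 ^ n) x = rademacher R n x.
Proof.
rewrite /walsh (bigD1 (Ordinal (ltn_expl n (ltnSn 1))))//= big1 ?mulr1.
  by rewrite digit_pow2 eqxx expr1.
by move=> k; rewrite -val_eqE /= digit_pow2 => /negbTE ->.
Qed.

Lemma depends_on_walsh n k : (k < 2 ^ n)%N -> depends_on n (walsh R k).
Proof.
move=> kn x y xy; apply: eq_bigr => j _.
have [jn|nj] := ltnP j n; first by rewrite /rademacher xy.
by rewrite /digit divn_small// (leq_trans kn)// leq_exp2l.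
Qed.

End walsh.

(** * The martingale and its Fourier coefficients *)

Section atoms.
Variables (R : realType) (mu : probability dyadic_group R).
Hypothesis mu_haar : normalized_haar mu.
Variable b : R.

(* With D_k the Walsh-Dirichlet kernel, this is
   (b / 2)^m (D_{2^(m+1)} - D_{2^m}), a multiple of a p-atom. *)
Definition scaled_atom (m : nat) (x : dyadic_group) : R :=
  b ^+ m * rademacher R m x * \1_(cyl m (fun=> false)) x.

Definition atom_sum (n : nat) (x : dyadic_group) : R :=
  \sum_(m < n) scaled_atom m x.

Lemma atom_sumS n x : atom_sum n.+1 x = atom_sum n x + scaled_atom n x.
Proof. exact: big_ord_recr. Qed.

Lemma depends_on_scaled_atom m : depends_on m.+1 (scaled_atom m).
Proof.
apply: (depends_on_comp2 *%R).
  by apply: (depends_on_comp2 *%R) => //; exact: depends_on_rademacher.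
apply: (depends_onW (leqnSn m)); apply: depends_on_indic.
exact: depends_on_cyl.
Qed.

Lemma scaled_atom_flip m x : scaled_atom m (flip m x) = - scaled_atom m x.
Proof.
rewrite /scaled_atom rademacher_flip mulrN mulNr depends_on_flip//.
by apply: depends_on_indic; exact: depends_on_cyl.
Qed.

Lemma depends_on_atom_sum n : depends_on n (atom_sum n).
Proof.
elim: n => [x y _|n IH]; first by rewrite /atom_sum !big_ord0.
move=> x y xy; rewrite !atom_sumS (@depends_on_scaled_atom n _ _ xy).
by rewrite (depends_onW (leqnSn n) IH xy).
Qed.

(** The increment [scaled_atom n] is odd under [flip n], which leaves every set of [zeta m] with
    [m <= n] invariant, so its integral over such a set is 0. *)
Lemma martingale_atom_sum : martingale mu atom_sum.
Proof.
split=> [n _ B _|n|m n mn A].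
- rewrite setTI; apply: depends_on_preimage; exact: depends_on_atom_sum.
- exact: (depends_on_integrable _ (@depends_on_atom_sum n)).
move=> zA; have mA := zeta_measurable zA; move/zetaE in zA.
elim: n mn => [|n IH]; first by rewrite leqn0 => /eqP ->.
rewrite leq_eqVlt => /predU1P[->//|mn]; rewrite -IH//.
under eq_integral do rewrite atom_sumS EFinD.
rewrite integralD//=; last 2 first.
- exact: (depends_on_integrable _ (@depends_on_atom_sum n)).
- exact: (depends_on_integrable _ (@depends_on_scaled_atom n)).
have An : flip n @^-1` A = A.
  apply/funext => x; rewrite /preimage /mkset depends_on_flip//.
  exact: depends_onW zA.
have dn := @depends_on_scaled_atom n.
by rewrite (integral_flip_odd mu_haar mA An dn (@scaled_atom_flip n)) adde0.
Qed.

Lemma atom_sum_coef n :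
  fourier_coef mu atom_sum (2 ^ n) = (b / 2) ^+ n.
Proof.
(* The sequence defining the coefficient is constant from [N = n.+1] on: only the atom of index [n]
   contributes, with [r_n ^ 2 = 1] leaving [b ^ n] times the measure of [I_n(0)]. *)
suff E N : \int[mu]_x (atom_sum N x * walsh R (2 ^ n) x) =
    if (n < N)%N then (b / 2) ^+ n else 0.
  rewrite /fourier_coef; apply: lim_near_cst; first exact: Rhausdorff.
  by exists n.+1 => // N /= nN; rewrite E nN.
have dw : depends_on n.+1 (walsh R (2 ^ n)).
  by apply: depends_on_walsh; rewrite ltn_exp2l.
elim: N => [|N IH].
  under eq_Rintegral do rewrite /atom_sum big_ord0 mul0r.
  by rewrite Rintegral_cst// mul0r.
have dF M : depends_on (maxn M n.+1)
    (fun x => atom_sum M x * walsh R (2 ^ n) x).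
  apply: (depends_on_comp2 *%R).
    by apply: depends_onW (@depends_on_atom_sum M); exact: leq_maxl.
  by apply: depends_onW dw; exact: leq_maxr.
have dt : depends_on (maxn N n).+1
    (fun x => scaled_atom N x * walsh R (2 ^ n) x).
  apply: (depends_on_comp2 *%R).
    by apply: depends_onW (@depends_on_scaled_atom N); rewrite ltnS leq_maxl.
  by apply: depends_onW dw; rewrite ltnS leq_maxr.
under eq_Rintegral do rewrite atom_sumS mulrDl.
rewrite RintegralD//; last 2 first.
- exact: (depends_on_integrable _ (dF N)).
- exact: (depends_on_integrable _ dt).
rewrite IH ltnS [(n <= N)%N]leq_eqVlt; have [->|nN] := eqVneq n N.
  rewrite ltnn add0r /=.
  under eq_Rintegral do rewrite walsh_pow2 /scaled_atom mulrAC
    -[_ * rademacher _ _ _ * rademacher _ _ _]mulrA rademacher_sqr mulr1.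
  rewrite RintegralZl//; last first.
    by apply: integrable_indic; exact: measurable_cyl.
  rewrite /Rintegral integral_indic//; last exact: measurable_cyl.
  have /normalized_haarP/(_ N (fun=> false)) cN := mu_haar.
  by rewrite setIT [X in fine X]cN /= expr_div_n.
rewrite /= -[RHS]addr0; congr +%R; rewrite /Rintegral.
(* Flip the coordinate of larger index: of the two factors, the one with that index changes sign and
   the other does not see the flip. *)
rewrite (@integral_flip_odd _ _ mu_haar (maxn n N) _ _ _ _ _ dt)// => x.
move: nN; rewrite neq_ltn => /orP[nN|Nn].
  rewrite (maxn_idPr (ltnW nN)) scaled_atom_flip mulNr depends_on_flip//.
  by apply: depends_onW dw.
rewrite (maxn_idPl (ltnW Nn)) !walsh_pow2 rademacher_flip mulrN.
rewrite depends_on_flip//.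
by apply: depends_onW (@depends_on_scaled_atom N).
Qed.

(** * The maximal function and membership in [H_p] *)

Hypothesis b_ge2 : 2 <= b.

Let b_ge0 : 0 <= b.
Proof. exact: le_trans (ler0n R 2) b_ge2. Qed.

Lemma normr_scaled_atom_le m x : `|scaled_atom m x| <= b ^+ m.
Proof.
rewrite /scaled_atom !normrM normr_rademacher mulr1 ger0_norm ?exprn_ge0//.
rewrite ler_piMr ?exprn_ge0// indicE.
by case: (_ \in _); rewrite ?normr1 ?normr0.
Qed.

Lemma normr_atom_sum_le n x : `|atom_sum n x| <= b ^+ n.
Proof.
elim: n => [|n IH]; first by rewrite /atom_sum big_ord0 normr0 expr0.
rewrite atom_sumS (le_trans (ler_normD _ _))// exprS.
apply: le_trans (lerD IH (normr_scaled_atom_le n x)) _.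
by rewrite -mulr2n -[leLHS]mulr_natl ler_wpM2r ?exprn_ge0.
Qed.

(** Induction on [n]: outside [I_n(0)] the new atom vanishes and [j] is kept; inside, [j = n] works,
    since the old sum and the new atom are each at most [b ^ n]. *)
Lemma normr_atom_sum_le_cyl n x :
  exists2 j, cyl j (fun=> false) x & `|atom_sum n x| <= 2 * b ^+ j.
Proof.
elim: n => [|n [j xj IH]].
  by exists 0%N => //; rewrite /atom_sum big_ord0 normr0 mulr1.
have [xn|xn] := boolP (x \in cyl n (fun=> false)); last first.
  exists j => //; rewrite atom_sumS /scaled_atom indicE (negbTE xn).
  by rewrite mulr0 addr0.
exists n; first by rewrite inE in xn.
rewrite atom_sumS (le_trans (ler_normD _ _))// mulr_natl mulr2n.
by rewrite lerD ?normr_atom_sum_le ?normr_scaled_atom_le.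
Qed.

Variable p : R.
Hypotheses (p_gt0 : 0 < p) (bp_lt2 : b `^ p < 2).

Let c (j : nat) : R := (2 * b ^+ j) `^ p.

(** A sum in place of a supremum, to be integrated term by term. It is extended-real valued because
    it diverges at the zero sequence. *)
Let majorant (x : dyadic_group) : \bar R :=
  (\sum_(0 <= j <oo) (c j * \1_(cyl j (fun=> false)) x)%:E)%E.

Let c_ge0 j : 0 <= c j. Proof. exact: powR_ge0. Qed.

Let term_ge0 j x : 0 <= c j * \1_(cyl j (fun=> false)) x.
Proof. by rewrite mulr_ge0// indicE ler0n. Qed.

Let depends_on_majorant_term j :
  depends_on j (fun x => c j * \1_(cyl j (fun=> false)) x).
Proof.
apply: (depends_on_comp2 *%R) => //.
by apply: depends_on_indic; exact: depends_on_cyl.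
Qed.

Let measurable_majorant_term j :
  measurable_fun setT (fun x => (c j * \1_(cyl j (fun=> false)) x)%:E).
Proof. by apply: depends_on_emeasurable. Qed.

Let majorant_ge0 x : (0 <= majorant x)%E.
Proof. by apply: nneseries_ge0 => n _ _; rewrite lee_fin. Qed.

Let maximal_ge0 x : (0 <= maximal atom_sum x)%E.
Proof.
apply: le_ereal_sup_tmp.
by exists `|atom_sum 0 x|%:E; [exists 0%N|rewrite lee_fin].
Qed.

Let maximal_le_majorant x : (maximal atom_sum x `^ p <= majorant x)%E.
Proof.
(* With the [p]-th root moved to the right, the supremum can be bounded one index at a time, each
   time by a single term of the series. *)
suff h : (maximal atom_sum x <= majorant x `^ p^-1)%E.
  rewrite -[leRHS]poweRe1// -(mulVf (lt0r_neq0 p_gt0)) poweRrM.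
  apply: gt0_ler_poweR => //; rewrite ?(ltW p_gt0)// in_itv/= leey.
    by rewrite maximal_ge0.
  by rewrite poweR_ge0.
apply: ge_ereal_sup => _ [n _ <-].
have [j xj le] := normr_atom_sum_le_cyl n x.
apply: (@le_trans _ _ (2 * b ^+ j)%:E); first by rewrite lee_fin.
have -> : (2 * b ^+ j)%:E = ((c j)%:E `^ p^-1)%E.
  rewrite poweR_EFin /c -powRrM mulfV ?lt0r_neq0// powRr1//.
  by rewrite mulr_ge0 ?exprn_ge0.
apply: gt0_ler_poweR; rewrite ?invr_ge0 ?(ltW p_gt0) ?in_itv/= ?leey
  ?lee_fin ?c_ge0 ?majorant_ge0//.
apply: (@le_trans _ _ (\sum_(0 <= i < j.+1)
    (c i * \1_(cyl i (fun=> false)) x)%:E)%E); last first.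
  by apply: nneseries_lim_ge => i _ _; rewrite lee_fin.
rewrite big_nat_recr//= indicE mem_set// mulr1 leeDr//.
by apply: sume_ge0 => i _; rewrite lee_fin.
Qed.

Let integral_majorant : (\int[mu]_x majorant x < +oo)%E.
Proof.
rewrite integral_nneseries//; last by move=> n x _; rewrite lee_fin.
set d := b `^ p / 2.
have d_ge0 : 0 <= d by rewrite divr_ge0 ?powR_ge0.
have d_lt1 : d < 1 by rewrite ltr_pdivrMr ?mul1r.
(* [I_j(0)] has measure [2 ^- j], which turns [(b ^ p) ^ j] into [d ^ j]. *)
have E j : (\int[mu]_x (c j * \1_(cyl j (fun=> false)) x)%:E)%E =
    (2 `^ p * d ^+ j)%:E.
  have mj : measurable (cyl j (fun=> false)) := measurable_cyl _ _.
  under eq_integral do rewrite EFinM.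
  rewrite integralZl//=; last exact: integrable_indic.
  rewrite integral_indic// setIT.
  have /normalized_haarP/(_ j (fun=> false)) cj := mu_haar.
  rewrite [X in (_ * X)%E]cj -EFinM /c powRM ?exprn_ge0// -mulrA.
  congr (_ * _)%:E; rewrite -powR_mulrn// -powRrM [_ * p]mulrC powRrM.
  by rewrite powR_mulrn ?powR_ge0// expr_div_n.
apply: (@le_lt_trans _ _ (2 `^ p / (1 - d))%:E); last exact: ltry.
apply: lime_le.
  apply: is_cvg_nneseries => n _ _.
  by rewrite E lee_fin mulr_ge0 ?powR_ge0 ?exprn_ge0.
near=> n.
under eq_bigr do rewrite E.
rewrite sumEFin lee_fin -mulr_sumr ler_wpM2l ?powR_ge0//.
rewrite -[leRHS]mul1r ler_pdivlMr ?subr_gt0// big_mkord mulrC.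
by rewrite -opprB mulNr -subrX1 opprB gerBl exprn_ge0.
Unshelve. all: by end_near. Qed.

Lemma Hp_atom_sum : Hp mu p atom_sum.
Proof.
split; first exact: martingale_atom_sum.
rewrite /norm_Hp unlock; apply: poweR_lty.
apply: le_lt_trans integral_majorant.
have mF : measurable_fun setT (fun x => maximal atom_sum x).
  (* The maximal function as the tail supremum from index 0, hence measurable. *)
  rewrite (_ : (fun x => _) = fun x => esups (fun n => `|atom_sum n x|%:E) 0).
    apply: measurable_fun_esups => n; apply/measurable_EFinP.
    apply: measurableT_comp => //.
    exact: depends_on_measurable (@depends_on_atom_sum n).
  apply/funext => x; congr ereal_sup; apply/seteqP.
  by split=> [_ [n _ <-]|_ [n _ <-]]; exists n.
apply: ge0_le_integral => //.
- by move=> x _; exact: poweR_ge0.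
- apply: (measurableT_comp (measurable_poweR p)) => //.
  exact: measurableT_comp.
- by apply: ge0_emeasurable_sum => // k x _ _; rewrite lee_fin.
by move=> x _; rewrite gee0_abs.
Qed.

End atoms.

(** * Lower bound for the weak quasi-norm and choice of parameters *)

Lemma gt1_ltr_powR {R : realType} (a : R) :
  1 < a -> {homo powR a : x y / x < y}.
Proof.
move=> a1 x y xy; have a0 : 0 < a by exact: lt_trans a1.
by rewrite /powR (gt_eqF a0) ltr_expR ltr_pM2r ?ln_gt0.
Qed.

(** The single level [l] suffices: its level set has measure at least 1/2, so the supremum is at
    least [l ^ p / 2]. *)
Lemma weak_norm_ge_flip (R : realType) (mu : probability dyadic_group R)
    (p : R) n N f (c l : R) : normalized_haar mu -> 0 < p ->
  (forall x, c <= `|f x| \/ c <= `|f (flip n x)|) -> depends_on N f ->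
  0 < l < c -> ((l * 2^-1 `^ p^-1)%:E <= weak_norm mu p f)%E.
Proof.
move=> mu_haar p_gt0 fc fN /andP[l0 lc].
have -> : (l * 2^-1 `^ p^-1)%:E = ((l `^ p * 2^-1)%:E `^ p^-1)%E.
  rewrite poweR_EFin powRM ?powR_ge0 ?invr_ge0// -powRrM mulfV ?lt0r_neq0//.
  by rewrite powRr1// ltW.
rewrite /weak_norm.
have h : ((l `^ p * 2^-1)%:E <= (l `^ p)%:E * mu [set x | (l < `|f x|)%R])%E.
  rewrite EFinM lee_wpmul2l ?lee_fin ?powR_ge0//.
  exact: measure_ge_half_flip fc fN lc.
apply: gt0_ler_poweR; rewrite ?invr_ge0 ?(ltW p_gt0)//.
- by rewrite in_itv/= leey lee_fin mulr_ge0 ?powR_ge0 ?invr_ge0.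
- rewrite in_itv/= leey andbT; apply: le_trans (ereal_sup_ubound _); last first.
    by exists l.
  by rewrite mule_ge0 ?lee_fin ?powR_ge0.
by apply: le_trans h _; apply: ereal_sup_ubound; exists l.
Qed.

Theorem corollary2 (R : realType) (mu : probability dyadic_group R)
    (mu_haar : normalized_haar mu) (p : R) (p_gt0 : 0 < p) (p_lt1 : p < 1) :
  exists F : nat -> dyadic_group -> R,
    Hp mu p F /\
    ereal_sup (range (fun n : nat =>
      weak_norm mu p (partial_sum mu F (2 ^ n + 1)%N))) = +oo%E.
Proof.
(* The midpoint of 1 and [1/p], so that [b = 2 ^ s] satisfies both [2 < b] and [b ^ p < 2]. *)
pose s := (1 + p^-1) / 2.
have s1 : 1 < s.
  have : 1 < p^-1 by rewrite invf_gt1.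
  by rewrite /s; lra.
have sp : s * p < 1 by rewrite /s mulrAC mulrDl mulVf ?lt0r_neq0//; lra.
pose b : R := 2 `^ s.
have b2 : 2 < b by rewrite -[ltLHS]powRr1// gt1_ltr_powR// ltr1n.
have bp : b `^ p < 2 by rewrite -powRrM -[ltRHS]powRr1// gt1_ltr_powR// ltr1n.
exists (atom_sum b); split; first exact: (Hp_atom_sum mu_haar (ltW b2)).
apply: eq_infty => t.
set k := 2^-1 `^ p^-1; have k0 : 0 < k by rewrite powR_gt0.
(* Chosen so that [t <= l * k]; the maximum with 1 keeps the level positive. *)
pose l := Num.max 1 (t / k).
have l0 : 0 < l by rewrite lt_max ltr01.
have [n ln] : exists n, l < (b / 2) ^+ n.
  (* The powers of [(b / 2)^-1] tend to 0, so one of them is below [l^-1]. *)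
  have z1 : `|(b / 2)^-1| < 1 by rewrite gtr0_norm ?invr_gt0 ?invf_lt1; lra.
  have l1 : 0 < l^-1 by rewrite invr_gt0.
  have [n _ /(_ n (leqnn n))] := cvgr0_norm_lt _ (cvg_expr z1) _ l1.
  have cn : 0 < (b / 2) ^+ n by rewrite exprn_gt0//; lra.
  by rewrite /= exprVn gtr0_norm ?invr_gt0// ltf_pV2//; exists n.
apply: le_trans (ereal_sup_ubound _); last by exists n.
apply: (@le_trans _ _ (l * k)%:E).
  by rewrite lee_fin -ler_pdivrMr// le_max lexx orbT.
apply: (@weak_norm_ge_flip _ _ _ n n.+1 _ ((b / 2) ^+ n)); rewrite ?l0//.
  set S := partial_sum mu (atom_sum b) (2 ^ n).
  have SE x : partial_sum mu (atom_sum b) (2 ^ n + 1) x =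
      S x + (b / 2) ^+ n * rademacher R n x.
    by rewrite addn1 /S /partial_sum big_ord_recr/= atom_sum_coef// walsh_pow2.
  have dS : depends_on n S.
    apply: depends_on_bigop => i; apply: (depends_on_comp2 *%R) => //.
    exact: depends_on_walsh.
  move=> x; rewrite !SE depends_on_flip// rademacher_flip mulrN.
  case: lerP => [|h1]; first by left.
  (* The values at [x] and at the flipped point differ by twice [(b / 2) ^ n * r_n]; if the first is
     smaller than [(b / 2) ^ n] in absolute value, the second is not. *)
  right; have := ler_normB (S x + (b / 2) ^+ n * rademacher R n x)
    (S x - (b / 2) ^+ n * rademacher R n x).
  rewrite opprB addrC addrA subrK -mulr2n normrMn normrM normr_rademacher.
  rewrite mulr1 ger0_norm.
    by move: h1; lra.
  by rewrite exprn_ge0//; lra.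
apply: depends_on_bigop => i; apply: (depends_on_comp2 *%R) => //.
apply: depends_on_walsh.
by rewrite (leq_trans (ltn_ord i))// addn1 ltn_exp2l.
Qed.
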